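(* Let $X$ be an infinite set with cardinality $\kappa$. Let $\Lambda$ be the direct product of a family of integral domains indexed by $X$, and let $\Gamma$ be the direct product of a family of local rings indexed by $X$. Then $|\operatorname{Min}(\Lambda)|=|\operatorname{Max}(\Gamma)|=|\operatorname{Spec}\mathcal{P}(X)|=2^{2^{\kappa}}$.
   Context: All rings are commutative with $1$; a local ring is a ring with exactly one maximal ideal (no Noetherian hypothesis). $\operatorname{Min}(R)$ and $\operatorname{Max}(R)$ denote the sets of minimal prime ideals and of maximal ideals of a ring $R$. $\mathcal{P}(X)$ denotes the power set ring of $X$: the set of all subsets of $X$ with addition $A+B=(A\cup B)\setminus(A\cap B)$ and multiplication $A\cdot B=A\cap B$. *)

(* Defs.v *)
From HB Require Import structures.
From mathcomp Require Import all_boot all_algebra all_classical.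

Set Implicit Arguments.
Unset Strict Implicit.
Unset Printing Implicit Defensive.

Import GRing.Theory.

Local Open Scope classical_set_scope.
Local Open Scope ring_scope.

(* MathComp's idealr and prime_idealr (ring_quotient) are boolean predicates on
   non-trivial rings; the notions below are for arbitrary commutative rings. *)
Section Ideals.
Variable R : comPzRingType.
Implicit Types I J : set R.

Definition is_ideal I : Prop :=
  [/\ I 0, forall a b, I a -> I b -> I (a + b) & forall r a, I a -> I (r * a)].

Definition is_proper_ideal I : Prop := is_ideal I /\ ~ I 1.

Definition is_prime_ideal I : Prop :=
  is_proper_ideal I /\ forall a b, I (a * b) -> I a \/ I b.

Definition is_maximal_ideal I : Prop :=
  is_proper_ideal I /\ forall J, is_proper_ideal J -> I `<=` J -> J = I.

Definition is_minimal_prime I : Prop :=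
  is_prime_ideal I /\ forall J, is_prime_ideal J -> J `<=` I -> J = I.

Definition Spec : set (set R) := [set I | is_prime_ideal I].
Definition Max : set (set R) := [set I | is_maximal_ideal I].
Definition Min : set (set R) := [set I | is_minimal_prime I].

End Ideals.

Arguments Spec : clear implicits.
Arguments Max : clear implicits.
Arguments Min : clear implicits.

Definition is_local_ring (R : comPzRingType) : Prop :=
  exists! M : set R, is_maximal_ideal M.

Definition prod_ring (X : Type) (A : X -> comPzRingType) : Type :=
  forall x : X, A x.

Section ProdRing.
Variables (X : Type) (A : X -> comPzRingType).
Implicit Types f g h : prod_ring A.

HB.instance Definition _ := gen_eqMixin (prod_ring A).
HB.instance Definition _ := gen_choiceMixin (prod_ring A).

Let zero : prod_ring A := fun=> 0.
Let opp f : prod_ring A := fun x => - f x.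
Let add f g : prod_ring A := fun x => f x + g x.
Let one : prod_ring A := fun=> 1.
Let mul f g : prod_ring A := fun x => f x * g x.

Let addA : associative add.
Proof. by move=> f g h; apply: functional_extensionality_dep => x; exact: addrA. Qed.
Let addC : commutative add.
Proof. by move=> f g; apply: functional_extensionality_dep => x; exact: addrC. Qed.
Let add0 : left_id zero add.
Proof. by move=> f; apply: functional_extensionality_dep => x; exact: add0r. Qed.
Let addN : left_inverse zero opp add.
Proof. by move=> f; apply: functional_extensionality_dep => x; exact: addNr. Qed.
Let mulA : associative mul.
Proof. by move=> f g h; apply: functional_extensionality_dep => x; exact: mulrA. Qed.
Let mulC : commutative mul.
Proof. by move=> f g; apply: functional_extensionality_dep => x; exact: mulrC. Qed.
Let mul1 : left_id one mul.
Proof. by move=> f; apply: functional_extensionality_dep => x; exact: mul1r. Qed.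
Let mulD : left_distributive mul add.
Proof. by move=> f g h; apply: functional_extensionality_dep => x; exact: mulrDl. Qed.

HB.instance Definition _ :=
  GRing.isZmodule.Build (prod_ring A) addA addC add0 addN.
HB.instance Definition _ :=
  GRing.Zmodule_isComPzRing.Build (prod_ring A) mulA mulC mul1 mulD.

End ProdRing.

(* The addition is setY, which setYE rewrites to (A `|` B) `\` (A `&` B); every
   element is its own opposite. *)
Definition power_ring (X : Type) : Type := set X.

Section PowerRing.
Variable X : Type.

HB.instance Definition _ := gen_eqMixin (power_ring X).
HB.instance Definition _ := gen_choiceMixin (power_ring X).

Let addNY : left_inverse set0 id (@setY X).
Proof. exact: setYK. Qed.

HB.instance Definition _ := GRing.isZmodule.Build (power_ring X)
  (@setYA X) (@setYC X) (@set0Y X) addNY.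
HB.instance Definition _ := GRing.Zmodule_isComPzRing.Build (power_ring X)
  (@setIA X) (@setIC X) (@setTI X) (@setIYl X).

End PowerRing.

(* Main.v *)
Require Import Defs.
From mathcomp Require Import all_boot all_algebra all_classical.

(** Both [Min] of a product of domains and [Max] of a product of local rings
are copies of [Spec] of the power set ring, and the latter is counted by a
classical independent-family argument.

A prime [q] of a product ring has a trace on the index set: the sets [S] whose
idempotent [idem S], equal to 1 on [S] and to 0 elsewhere, lies in [q].  The
trace is a prime ideal of the power set ring, that is, the complement of an
ultrafilter.  In the other direction, given one prime [Q x] in each factor, a
prime [I] of the power set ring yields the prime [limit_prime Q I] of those [f]
whose coordinates lie outside [Q] only on a set in [I]; this is the preimage of
the zero ideal of the ultraproduct of the quotients, and its trace is [I]
([trace_limit_prime]).  Thus the trace is surjective, and what remains is to see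
when [q] is recovered from its trace.
- For domains and [Q x = 0], every prime [q] contains the limit prime of its
  trace, because [f] is a multiple of the idempotent of its support.  As
  inclusions between primes of the power set ring are equalities
  ([power_prime_sub_eq]), the minimal primes are exactly the limit primes.
- For local rings and [Q x] the maximal ideal, every prime [q] is contained in
  the limit prime of its trace, because the idempotent of the set where [f] is
  invertible is a multiple of [f].  Hence the maximal ideals are exactly the
  limit primes.

For the count, [independent_family] gives subsets [B A] of [X], indexed by all
subsets [A] of [X], such that every prescribed finite pattern of memberships is
realized by a point.  So for each family [F] of subsets of [X], the complements
of [B A] for [A] in [F] and the sets [B A] for [A] outside [F] generate a proper
ideal, hence lie in a common prime.  Distinct families give distinct primes, so
there are at least as many primes as families of subsets; the converse bound is
clear since a prime is itself such a family.
The family comes from the finite lists [S :: T] of finite lists: [B A] holds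
when the part of [S] in [A] is one of the members of [T].  These lists embed in
[X] by [card_seq_le], the fact that an infinite set is as large as the set of
its finite lists.  This last fact is proved with Zorn's lemma, by extending
codings of the lists over a subset of [X] by elements of that subset. *)

Set Implicit Arguments.
Unset Strict Implicit.
Unset Printing Implicit Defensive.

Import GRing.Theory.

Local Open Scope classical_set_scope.
Local Open Scope card_scope.

(** * Zorn's lemma and comparability of cardinals *)

(** [Zorn_bigcup] asks for the union of the empty chain as well, which fails for
proper ideals and for codings; starting from a given member [A0] removes that
case. *)
Lemma Zorn_bigcup_above (T : Type) (P : set (set T)) (A0 : set T) :
    P A0 ->
    (forall F : set (set T), F !=set0 -> F `<=` P -> total_on F subset ->
      P (\bigcup_(G in F) G)) ->
  exists A, [/\ P A, A0 `<=` A & forall B, P B -> A `<=` B -> B = A].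
Proof.
move=> PA0 Pchain.
(* Applied to the sets [G] such that [A0 `|` G] satisfies [P], the empty union
   becomes [A0] itself. *)
have [F FP Ftot|A [PA Amax]] := @Zorn_bigcup T [set G | P (A0 `|` G)].
  have [F0|/eqP F0] := eqVneq F set0.
    by rewrite F0 bigcup_set0 /= setU0.
  have [G0 FG0] : F !=set0 by apply/set0P/eqP.
  rewrite /= (_ : _ `|` _ = \bigcup_(G in [set A0 `|` G | G in F]) G).
    apply: Pchain; first by exists (A0 `|` G0), G0.
      by move=> _ [G FG <-]; exact: FP.
    move=> _ _ [G FG <-] [H FH <-].
    by have [GH|HG] := Ftot _ _ FG FH; [left|right]; exact: setUS.
  apply/seteqP; split=> [t [A0t|[G FG Gt]]|t [_ [G FG <-] [A0t|Gt]]].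
  - by exists (A0 `|` G0); [exists G0|left].
  - by exists (A0 `|` G); [exists G|right].
  - by left.
  - by right; exists G.
exists (A0 `|` A); split=> // B PB sAB.
have [sA0B sAB'] : A0 `<=` B /\ A `<=` B by move: sAB; rewrite subUset.
have B0 : A0 `|` B = B by apply/setUidPr.
apply: contrapT => nBA; apply: (Amax B); last by rewrite /= B0.
split=> // sBA; apply: nBA; apply/seteqP; split=> // t /sBA; by right.
Qed.

(** A partial injection, encoded as its graph so that the union of a chain is
again one. *)
Definition one_to_one (T U : Type) (G : set (T * U)) : Prop :=
  forall p q, G p -> G q -> p.1 = q.1 <-> p.2 = q.2.

Lemma bigcup_chain2 (T : Type) (F : set (set T)) (p q : T) :
  total_on F subset -> (\bigcup_(G in F) G) p -> (\bigcup_(G in F) G) q ->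
  exists2 G, F G & G p /\ G q.
Proof.
move=> Ftot [G FG Gp] [H FH Hq].
have [GH|HG] := Ftot _ _ FG FH; first by exists H => //; split=> //; exact: GH.
by exists G => //; split=> //; exact: HG.
Qed.

Lemma one_to_one_bigcup (T U : Type) (F : set (set (T * U))) :
  F `<=` @one_to_one T U -> total_on F subset ->
  one_to_one (\bigcup_(G in F) G).
Proof.
move=> Finj Ftot p q Fp Fq.
by have [G FG [Gp Gq]] := bigcup_chain2 Ftot Fp Fq; exact: (Finj G).
Qed.

(** In a maximal partial injection from [A] to [B], the domain is all of [A] or
the range is all of [B]; otherwise one more pair could be added. *)
Lemma card_le_total (T U : Type) (A : set T) (B : set U) :
  A #<= B \/ B #<= A.
Proof.
have [F FP Ftot|G [[GAB Ginj] Gmax]] :=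
    @Zorn_bigcup _ [set G | G `<=` A `*` B /\ @one_to_one T U G].
  split; last by apply: one_to_one_bigcup => // G /FP[].
  by move=> p [G /FP[GAB _] /GAB].
have G1 : fst @` G #= G.
  by apply: inj_card_eq => p q /set_mem Gp /set_mem Gq e;
    rewrite (surjective_pairing p) (surjective_pairing q) e
            ((Ginj _ _ Gp Gq).1 e).
have G2 : snd @` G #= G.
  by apply: inj_card_eq => p q /set_mem Gp /set_mem Gq e;
    rewrite (surjective_pairing p) (surjective_pairing q) e
            ((Ginj _ _ Gp Gq).2 e).
have le1 : fst @` G #<= B.
  rewrite (card_le_eql G1) -(card_le_eql G2).
  by apply: subset_card_le => _ [p /GAB[_ ?] <-].
have le2 : snd @` G #<= A.
  rewrite (card_le_eql G2) -(card_le_eql G1).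
  by apply: subset_card_le => _ [p /GAB[? _] <-].
have [/subset_card_le sA|nA] := pselect (A `<=` fst @` G).
  by left; exact: card_le_trans sA le1.
have [/subset_card_le sB|nB] := pselect (B `<=` snd @` G).
  by right; exact: card_le_trans sB le2.
have [a [Aa Ga]] : exists a, A a /\ ~ (fst @` G) a.
  apply: contrapT => H; apply: nA => a Aa; apply: contrapT => Ga.
  by apply: H; exists a.
have [b [Bb Gb]] : exists b, B b /\ ~ (snd @` G) b.
  apply: contrapT => H; apply: nB => b Bb; apply: contrapT => Gb.
  by apply: H; exists b.
case: (Gmax (G `|` [set (a, b)])).
  split; first by move=> p; left.
  by move=> /(_ (a, b) (or_intror erefl)) Gab; apply: Ga; exists (a, b).
split; first by move=> p [/GAB//|->].
move=> p q [Gp|->] [Gq|->]; first exact: Ginj.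
- by split=> /= e; [case: Ga|case: Gb]; exists p.
- by split=> /= e; [case: Ga|case: Gb]; exists q.
- by [].
Qed.

(** * Finite lists over an infinite set *)

Definition coded (X : Type) (G : set (seq X * X)) : set X :=
  [set x | exists y, G ([:: x], y)].

(** The set whose lists are coded is read off from the graph instead of being
carried along with it, so that codings are ordered by inclusion of graphs and
the union of a chain of graphs is the only thing to form. *)
Definition list_coding (X : Type) (G : set (seq X * X)) : Prop :=
  [/\ one_to_one G,
      forall s y, G (s, y) -> all (mem (coded G)) s /\ coded G y &
      forall s, all (mem (coded G)) s -> exists y, G (s, y)].

Lemma codedS (X : Type) (G H : set (seq X * X)) :
  G `<=` H -> coded G `<=` coded H.
Proof. by move=> GH x [y /GH Hxy]; exists y. Qed.

Lemma all_codedS (X : Type) (G H : set (seq X * X)) s :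
  G `<=` H -> all (mem (coded G)) s -> all (mem (coded H)) s.
Proof.
by move=> /codedS GH; apply: sub_all => x /set_mem /GH; exact: mem_set.
Qed.

(** The entries of a list over the union are finitely many, hence all coded by a
single member of the chain. *)
Lemma list_coding_bigcup (X : Type) (F : set (set (seq X * X))) :
  F !=set0 -> F `<=` @list_coding X -> total_on F subset ->
  list_coding (\bigcup_(G in F) G).
Proof.
move=> [G0 FG0] FL Ftot.
have sF G : F G -> G `<=` \bigcup_(H in F) H by move=> FG p Gp; exists G.
split.
- by apply: one_to_one_bigcup => // G /FL[].
- move=> s y [G FG Gsy]; have [_ /(_ _ _ Gsy)[Gs Gy] _] := FL _ FG.
  by split; [exact: all_codedS (sF _ FG) Gs|exact: codedS (sF _ FG) _ Gy].
- move=> s sU; suff [G FG Gs] : exists2 G, F G & all (mem (coded G)) s.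
    by have [_ _ /(_ _ Gs)[y Gsy]] := FL _ FG; exists y, G.
  elim: s sU => [_|x s IHs /andP[/set_mem[y [H FH Hxy]] /IHs[G FG Gs]]].
    by exists G0.
  have Hx : x \in coded H by apply: mem_set; exists y.
  have [GH|HG] := Ftot _ _ FG FH.
    by exists H => //=; rewrite Hx (all_codedS GH Gs).
  exists G => //=; rewrite Gs andbT.
  by apply: mem_set; apply: codedS HG _ (set_mem Hx).
Qed.

(** The start of the Zorn argument: a copy of [nat] in [X], whose lists are coded
by [pickle]. *)
Lemma list_coding_nat (X : Type) : infinite_set [set: X] ->
  exists2 G : set (seq X * X), list_coding G & coded G !=set0.
Proof.
elim/Ppointed: X => X; first by rewrite emptyE => /(_ (finite_set0 _)).
move=> /infiniteP/pcard_injP[i /in2TT iinj].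
pose G := [set (map i t, i (pickle t)) | t in [set: seq nat]].
have codedE x : coded G x <-> exists n, x = i n.
  split=> [[y [[|n t] _ // [<- _ _]]]|[n ->]]; first by exists n.
  by exists (i (pickle [:: n])), [:: n].
exists G; last by exists (i 0); apply/codedE; exists 0.
split.
- move=> _ _ [t _ <-] [u _ <-] /=; split=> [/(inj_map iinj) -> //|/iinj e].
  by rewrite (pcan_inj pickleK e).
- move=> _ _ [t _ [<- <-]]; split; last by apply/codedE; eexists.
  by apply/allP => _ /mapP[n _ ->]; apply/mem_set/codedE; exists n.
- move=> s sG; suff [t ->] : exists t, s = map i t.
    by exists (i (pickle t)), t.
  elim: s sG => [_|x s IHs /= /andP[/set_mem/codedE[n ->] /IHs[t ->]]].
    by exists [::].
  by exists (n :: t).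
Qed.

Lemma list_coding_fun (X : pointedType) (G : set (seq X * X)) :
  list_coding G -> exists2 f : seq X -> X,
    forall s, all (mem (coded G)) s -> G (s, f s) /\ coded G (f s) &
    forall s t, all (mem (coded G)) s -> all (mem (coded G)) t ->
      f s = f t -> s = t.
Proof.
move=> [Ginj Gdom Gtot].
have /choice[f fP] s : exists y, all (mem (coded G)) s -> G (s, y).
  have [/Gtot[y Gsy]|nGs] := boolP (all (mem (coded G)) s); first by exists y.
  by exists point.
exists f => [s Ys|s t /fP Gs /fP Gt]; last by move/(Ginj _ _ Gs Gt).
by split; [exact: fP|have [] := Gdom _ _ (fP _ Ys)].
Qed.

(** A coded set absorbs a disjoint set no larger than itself: elements [x] of the
coded set become the list [:: x], the others are sent into the coded set by some
[h] and become [:: h x; h x], so that the length tells the two kinds apart. *)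
Lemma list_coding_absorb (X : pointedType) (G : set (seq X * X)) (Z : set X) :
  list_coding G -> Z `\` coded G #<= coded G ->
  exists2 c : X -> X, set_fun Z (coded G) c & set_inj Z c.
Proof.
move=> /list_coding_fun[f fP finj] /pcard_leP[h].
set Y := coded G.
pose code x := if x \in Y then [:: x] else [:: h x; h x].
have codeY x : Z x -> all (mem Y) (code x).
  rewrite /code => Zx; case: ifPn => [xY|xNY] /=; first by rewrite xY.
  rewrite !andbT andbb; apply/mem_set/funS; split=> // Yx.
  by move: xNY; rewrite (mem_set Yx).
exists (f \o code) => [x /codeY/fP[]//|x y /set_mem Zx /set_mem Zy /= e].
have := finj _ _ (codeY _ Zx) (codeY _ Zy) e.
rewrite /code; case: ifPn => xY; case: ifPn => yY // [] // hxy _.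
by apply: (inj (f := h)) => //; rewrite in_setD ?xY ?yY mem_set.
Qed.

(** Let [Y] be the coded set of a maximal coding.  If the complement of [Y] embeds
in [Y], then all of [X] embeds in [Y], and lists over [X] are coded through
lists over [Y].  Otherwise [Y] has a copy [h @` Y] outside itself, and this copy
provides room to code the new lists over [Y `|` h @` Y], against maximality. *)
Lemma card_seq_le (X : Type) :
  infinite_set [set: X] -> [set: seq X] #<= [set: X].
Proof.
elim/Ppointed: X => X; first by rewrite emptyE => /(_ (finite_set0 _)).
move=> /list_coding_nat[G0 G0L [x0 G0x0]].
have [G [GL G0G Gmax]] := Zorn_bigcup_above G0L (@list_coding_bigcup X).
have Yx0 := codedS G0G G0x0.
have [f fP finj] := list_coding_fun GL.
move Ydef : (coded G) => Y in fP finj Yx0.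
have [nYY|/pcard_leP[h]] := card_le_total (~` Y) Y.
  have [|c cY cinj] := @list_coding_absorb _ _ setT GL.
    by rewrite setTD Ydef.
  have cP s : all (mem Y) (map c s).
    rewrite all_map; apply: sub_all (all_predT s) => x _; apply/mem_set.
    by rewrite -Ydef; exact: cY.
  apply/pcard_injP; exists (f \o map c) => s t _ _ /= /(finj _ _ (cP s) (cP t)).
  by apply: inj_map => x y; apply: cinj; rewrite inE.
pose Z := Y `|` h @` Y.
have [|c cY cinj] := @list_coding_absorb _ _ Z GL.
  rewrite Ydef /Z; apply: card_le_trans (card_image_le h Y).
  by apply: subset_card_le => x [[]].
rewrite Ydef in cY.
have cP s : all (mem Z) s -> all (mem Y) (map c s).
  by rewrite all_map; apply: sub_all => x /set_mem Zx; apply/mem_set; exact: cY.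
pose G' := G `|` [set (s, h (f (map c s))) | s in
                   [set s | all (mem Z) s && ~~ all (mem Y) s]].
have G'Z : coded G' = Z.
  apply/seteqP; split=> x.
    move=> [y [Gxy|[s /andP[sZ _] [e _]]]].
      by left; rewrite -Ydef; exists y.
    by move: sZ; rewrite e /= andbT => /set_mem.
  move=> Zx; have [Yx|nYx] := boolP (x \in Y).
    by move/set_mem: Yx; rewrite -Ydef => -[y Gxy]; exists y; left.
  exists (h (f (map c [:: x]))); right; exists [:: x] => //.
  by rewrite /= !andbT; apply/andP; split; [exact/mem_set|exact: nYx].
have sYZ : {subset Y <= Z} by move=> x /set_mem Yx; apply/mem_set; left.
have G'L : list_coding G'.
  have [Ginj Gdom Gtot] := GL; rewrite Ydef in Gdom Gtot.
  have new s y : G (s, y) -> forall t, all (mem Z) t && ~~ all (mem Y) t ->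
      ~ s = t /\ ~ y = h (f (map c t)).
    move=> /Gdom[sY yY] t /andP[tZ ntY]; split=> [st|e].
      by move: ntY; rewrite -st sY.
    by have [_ /'funS_h] := fP _ (cP _ tZ); rewrite /= -e.
  split; rewrite ?G'Z.
  - move=> [s y] [t z] [Gsy|[s' s'P [<- <-]]] [Gtz|[t' t'P [<- <-]]] /=.
    + exact: (Ginj (s, y) (t, z)).
    + by have [] := new _ _ Gsy _ t'P.
    + by have [n1 n2] := new _ _ Gtz _ s'P; split=> /esym.
    + split=> [->//|e]; have /andP[sZ _] := s'P; have /andP[tZ _] := t'P.
      have e1 : f (map c s') = f (map c t').
        apply: (inj (f := h)) e; apply/mem_set.
          by have [] := fP _ (cP _ sZ).
        by have [] := fP _ (cP _ tZ).
      move/(finj _ _ (cP _ sZ) (cP _ tZ)): e1.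
      elim: s' t' sZ tZ {e s'P t'P} => [|a u IH] [|b v] //=.
      by move=> /andP[aZ uZ] /andP[bZ vZ] [/(cinj _ _ aZ bZ) -> /IH ->].
  - move=> s y [/Gdom[sY Yy]|[t /andP[tZ _] [<- <-]]].
      by split; [apply: sub_all sY|left].
    by split=> //; right; exists (f (map c t)) => //; have [] := fP _ (cP _ tZ).
  - move=> s sZ; have [/Gtot[y Gsy]|nsY] := boolP (all (mem Y) s).
      by exists y; left.
    by exists (h (f (map c s))); right; exists s => //=; rewrite sZ.
have GG' : G' = G by apply: Gmax => //; apply: subsetUl.
have ZY : Z `<=` Y by rewrite -G'Z GG' Ydef.
have /ZY Yhx0 : Z (h x0) by right; exists x0.
by have /'funS_h := Yx0.
Qed.

(** * Independent families *)

(** The Fichtenholz-Kantorovich-Hausdorff construction.  A finite [S] that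
separates the finitely many sets of [l] makes their parts in [S] distinct, and
listing in [T] the parts of the members of [F] realizes the pattern [F] on
[l]. *)
Lemma independent_family (X : Type) : infinite_set [set: X] ->
  exists B : set X -> set X, forall (F : set (set X)) (l : seq (set X)),
    exists x, forall A, A \in l -> B A x <-> F A.
Proof.
move=> /card_seq_le.
elim/Ppointed: X => X.
  by rewrite emptyE => /eqP; rewrite -subset0 => /(_ [::] I).
move=> /pcard_injP[phi /in2TT phi_inj].
pose psi (t : seq (seq X)) := phi (map phi t).
have psi_inj : injective psi by move=> s t /phi_inj/(inj_map phi_inj).
pose part (A : set X) (s : seq X) := [seq x <- s | x \in A].
exists (fun A => psi @` [set t | part A (head [::] t) \in behead t]) => F l.
(* A point separating each pair of distinct sets. *)
have /choice[d dP] (p : set X * set X) :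
    exists x, p.1 <> p.2 -> ~ (p.1 x <-> p.2 x).
  have [?|ne] := pselect (p.1 = p.2); first by exists point.
  apply: contrapT => nx; apply: ne; apply/seteqP.
  split=> x px; apply: contrapT => npx; apply: nx; exists x => _ [h12 h21].
    exact: npx (h12 px).
  exact: npx (h21 px).
pose S := [seq d (A, C) | A <- l, C <- l].
pose t := S :: [seq part A S | A <- l & A \in F].
exists (psi t) => A Al; split=> [[u + /psi_inj ut]|FA]; last first.
  exists t => //=; apply: map_f; by rewrite mem_filter mem_set.
rewrite /= {}ut /= => /mapP[C]; rewrite mem_filter => /andP[/set_mem FC Cl] AC.
suff -> : A = C by [].
apply: contrapT => /(dP (A, C)); apply => /=.
have dS : d (A, C) \in S by apply: allpairs_f.
have := congr1 (fun s => d (A, C) \in s) AC.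
rewrite !mem_filter dS !andbT => e.
by split=> /mem_set; [rewrite e|rewrite -e] => /set_mem.
Qed.

(** * Maximal ideals and local rings *)

Local Open Scope ring_scope.

Section Rings.
Variable R : comPzRingType.
Implicit Types I J M : set R.

Lemma exists_maximal_ideal I :
  is_proper_ideal I -> exists2 M, is_maximal_ideal M & I `<=` M.
Proof.
move=> Iproper.
have [F [J0 FJ0] FP Ftot|M [Mproper IM Mmax]] :=
    @Zorn_bigcup_above _ (@is_proper_ideal R) I Iproper; last first.
  by exists M => //; split.
split; last by move=> [J /FP[_ J1]].
split.
- by exists J0 => //; have [[]] := FP _ FJ0.
- move=> a b Fa Fb; have [J FJ [Ja Jb]] := bigcup_chain2 Ftot Fa Fb.
  by exists J => //; have [[_ JD _] _] := FP _ FJ; exact: JD.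
- move=> r a [J FJ Ja]; exists J => //.
  by have [[_ _ JM] _] := FP _ FJ; exact: JM.
Qed.

Definition ideal_adjoin I a : set R :=
  [set r | exists2 i, I i & exists s, r = i + s * a].

Lemma ideal_adjoinP I a : is_ideal I ->
  [/\ is_ideal (ideal_adjoin I a), I `<=` ideal_adjoin I a & ideal_adjoin I a a].
Proof.
move=> [I0 ID IM]; split.
- split.
  + by exists 0 => //; exists 0; rewrite mul0r addr0.
  + move=> _ _ [i Ii [s ->]] [j Ij [t ->]]; exists (i + j); first exact: ID.
    by exists (s + t); rewrite mulrDl addrACA.
  + move=> r _ [i Ii [s ->]]; exists (r * i); first exact: IM.
    by exists (r * s); rewrite mulrDr mulrA.
- by move=> i Ii; exists i => //; exists 0; rewrite mul0r addr0.
- by exists 0 => //; exists 1; rewrite mul1r add0r.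
Qed.

Lemma maximal_ideal_adjoin M a :
  is_maximal_ideal M -> ~ M a -> ideal_adjoin M a 1.
Proof.
move=> [[Mid _] Mmax] nMa; have [Jid MJ Ja] := ideal_adjoinP a Mid.
by apply: contrapT => J1; apply: nMa; rewrite -(Mmax _ (conj Jid J1) MJ).
Qed.

Lemma maximal_is_prime M : is_maximal_ideal M -> is_prime_ideal M.
Proof.
move=> Mmax; have [[[M0 MD MM] nM1] _] := Mmax; split=> // a b Mab.
have [|/(maximal_ideal_adjoin Mmax)[i Mi [s e]]] := pselect (M a); first by left.
right; rewrite -[b]mulr1 e mulrDr; apply: MD; first exact: MM.
by rewrite mulrCA [b * a]mulrC; exact: MM.
Qed.

(** A non-invertible element generates a proper ideal, which lies in some maximal
ideal, and [M] is the only one. *)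
Lemma local_invertible M a : is_local_ring R -> is_maximal_ideal M ->
  ~ M a -> exists b, b * a = 1.
Proof.
move=> [N [Nmax Nuniq]] Mmax nMa.
have zero_ideal : is_ideal [set (0 : R)].
  by split=> [//|_ _ -> ->|r _ ->] /=; rewrite ?addr0 ?mulr0.
have [aid _ aa] := ideal_adjoinP a zero_ideal.
have [[i -> [b e]]|na1] := pselect (ideal_adjoin [set 0] a 1).
  by exists b; rewrite e add0r.
have [K Kmax aK] := exists_maximal_ideal (conj aid na1).
by case: nMa; rewrite -(Nuniq _ Mmax) (Nuniq _ Kmax); exact: aK.
Qed.

End Rings.

(** * Prime ideals of the power set ring *)

Section PowerRing.
Variable X : Type.
Implicit Types (I J : set (power_ring X)) (A B : set X).

Lemma power_idealS I A B : is_ideal I -> A `<=` B -> I B -> I A.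
Proof. by move=> [_ _ IM] /setIidPl AB IB; rewrite -AB; exact: IM. Qed.

Lemma power_idealU I A B : is_ideal I -> I A -> I B -> I (A `|` B).
Proof.
move=> Iid IA IB; have [_ ID _] := Iid.
suff -> : A `|` B = setY A (B `\` A).
  by apply: ID => //; apply: (power_idealS Iid _ IB) => x [].
rewrite setYE; apply/seteqP; split=> x /=; have [] := pselect (A x); tauto.
Qed.

(** Ideals of the power set ring are the ideals of subsets in the order-theoretic
sense; unions are easier to handle than symmetric differences. *)
Lemma power_idealP I : I set0 ->
  (forall A B, A `<=` B -> I B -> I A) ->
  (forall A B, I A -> I B -> I (A `|` B)) -> is_ideal I.
Proof.
move=> I0 IS IU; split=> [//|A B IA IB|A B].
  by apply: (IS (setY A B) (A `|` B)); [rewrite setYE => x []|exact: IU].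
by apply: IS; exact: subIsetr.
Qed.

(** The complement of a prime ideal is an ultrafilter. *)
Lemma power_primeC I A : is_prime_ideal I -> I (~` A) <-> ~ I A.
Proof.
move=> [[Iid nI1] Ipr]; split=> [IcA IA|nIA].
  apply: nI1; suff -> : (1 : power_ring X) = A `|` ~` A by exact: power_idealU.
  by rewrite setUv.
have [I0 _ _] := Iid.
suff : I ((A : power_ring X) * (~` A : set X)) by case/Ipr.
suff -> : (A : power_ring X) * (~` A : set X) = 0 by [].
exact: setICr.
Qed.

(** Two ultrafilters, one inside the other, are equal. *)
Lemma power_prime_sub_eq I J :
  is_prime_ideal I -> is_prime_ideal J -> J `<=` I -> J = I.
Proof.
move=> Ipr Jpr JI; apply/seteqP; split=> // A IA.
apply: contrapT => /(power_primeC A Jpr).2/JI.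
by move/(power_primeC A Ipr).1.
Qed.

(** Pospisil's theorem on the number of ultrafilters. *)
Lemma card_Spec_power_ring : infinite_set [set: X] ->
  Spec (power_ring X) #= [set: set (set X)].
Proof.
move=> Xinf; apply: Cantor_Bernstein; first exact: card_leT.
have [B Bind] := independent_family Xinf.
pose N (F : set (set X)) (A : set X) := [set x | ~ (B A x <-> F A)].
(* [N F A] is the complement of [B A] when [A] is in [F], and [B A] otherwise;
   the ideal [I0] generated by these sets is proper since no finite union of them
   covers [X]. *)
have ex_prime F : exists I, is_prime_ideal I /\ forall A, I (N F A).
  pose I0 : set (power_ring X) :=
    [set S | exists l : seq (set X), forall x, S x -> exists2 A, A \in l & N F A x].
  have I0id : is_ideal I0.
    apply: power_idealP.
    - by exists [::].
    - by move=> S T ST [l lT]; exists l => x /ST/lT.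
    - move=> S T [l lS] [m mT]; exists (l ++ m) => x [/lS|/mT] [A Al nA].
        by exists A => //; rewrite mem_cat Al.
      by exists A => //; rewrite mem_cat Al orbT.
  have [|M /maximal_is_prime Mpr I0M] := @exists_maximal_ideal _ I0.
    split=> // -[l lT]; have [x xP] := Bind F l.
    by have [A Al] := lT x I; apply; exact: xP.
  exists M; split=> // A; apply: I0M; exists [:: A] => x Nx.
  by exists A; rewrite ?mem_head.
have [P PP] := choice ex_prime.
have Pinj : injective P.
  suff PS F G : P F = P G -> F `<=` G.
    by move=> F G e; apply/seteqP; split; apply: PS.
  move=> e A FA; apply: contrapT => nGA.
  have [[[Pid nP1] _] /(_ A) NF] := PP F; have [_ /(_ A)] := PP G.
  rewrite -e => NG; apply: nP1.
  apply: (power_idealS Pid _ (power_idealU Pid NF NG)) => x _.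
  have [Bx|nBx] := pselect (B A x); first by right; case=> /(_ Bx).
  by left; case=> _ /(_ FA).
have Pcard : P @` setT #= [set: set (set X)].
  by apply: inj_card_eq => F G _ _ /Pinj.
rewrite -(card_le_eql Pcard); apply: subset_card_le => _ [F _ <-].
by have [] := PP F.
Qed.

End PowerRing.

(** * Primes of a product ring and their traces *)

Section ProdRing.
Variables (X : Type) (A : X -> comPzRingType).
Implicit Types (q : set (prod_ring A)) (f g : prod_ring A) (S T : set X)
  (I : set (power_ring X)) (Q : forall x, set (A x)).

Definition idem S : prod_ring A := fun x => if `[< S x >] then 1 else 0.

Lemma idemT S x : S x -> idem S x = 1.
Proof. by rewrite /idem; case: asboolP. Qed.

Lemma idemF S x : ~ S x -> idem S x = 0.
Proof. by rewrite /idem; case: asboolP. Qed.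

Lemma prod_ringP f g : (forall x, f x = g x) -> f = g.
Proof. exact: functional_extensionality_dep. Qed.

Lemma prod_ringD f g x : (f + g) x = f x + g x. Proof. by []. Qed.

Lemma prod_ringM f g x : (f * g) x = f x * g x. Proof. by []. Qed.

Lemma idem_setT : idem setT = 1.
Proof. by apply: prod_ringP => x; rewrite idemT. Qed.

Lemma idem_set0 : idem set0 = 0.
Proof. by apply: prod_ringP => x; rewrite idemF. Qed.

Lemma idemI S T : idem (S `&` T) = idem S * idem T.
Proof.
apply: prod_ringP => x; rewrite prod_ringM.
have [Sx|nSx] := pselect (S x); last first.
  by rewrite (idemF nSx) mul0r idemF// => -[].
rewrite (idemT Sx) mul1r /idem; congr (if _ then _ else _).
by apply: asbool_equiv_eq; split=> [[]|].
Qed.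

Lemma idemU S T : idem (S `|` T) = idem S + idem (~` S) * idem T.
Proof.
apply: prod_ringP => x; rewrite prod_ringD prod_ringM.
have [Sx|nSx] := pselect (S x).
  by rewrite (idemT Sx) (@idemF (~` S)) ?mul0r ?addr0 ?idemT; [|left|exact].
rewrite (idemF nSx) (@idemT (~` S)) // mul1r add0r /idem.
by congr (if _ then _ else _); apply: asbool_equiv_eq; split=> [[]|]; [| |right].
Qed.

Lemma idem_supportE f S : (forall x, f x <> 0 -> S x) -> f = f * idem S.
Proof.
move=> fS; apply: prod_ringP => x; rewrite prod_ringM.
have [Sx|nSx] := pselect (S x); first by rewrite idemT// mulr1.
rewrite idemF// mulr0; apply: contrapT => /fS; exact: nSx.
Qed.

Definition trace q : set (power_ring X) := [set S | q (idem S)].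

Lemma trace_prime q : is_prime_ideal q -> is_prime_ideal (trace q).
Proof.
move=> [[[q0 qD qM] nq1] qpr]; split; last first.
  by move=> S T; rewrite /trace /= idemI; exact: qpr.
split; last by rewrite /trace /= idem_setT.
apply: power_idealP.
- by rewrite /trace /= idem_set0.
- by move=> S T /setIidPl <- qT; rewrite /trace /= idemI; exact: qM.
- by move=> S T qS qT; rewrite /trace /= idemU; apply: qD => //; exact: qM.
Qed.

(** The preimage in the product of the zero ideal of the ultraproduct of the rings
[A x / Q x] along the ultrafilter of complements of members of [I]. *)
Definition limit_prime Q I : set (prod_ring A) :=
  [set f | I [set x | ~ Q x (f x)]].

Lemma limit_primeP Q I : (forall x, is_prime_ideal (Q x)) ->
  is_prime_ideal I -> is_prime_ideal (limit_prime Q I).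
Proof.
move=> Qpr [[Iid nI1] Ipr]; split; [split; [split|]|].
- apply: (power_idealS Iid _ (_ : I set0)) => [x nQ|]; last by case: Iid.
  by apply: nQ; have [[[]]] := Qpr x.
- move=> f g If Ig; apply: (power_idealS Iid _ (power_idealU Iid If Ig)) => x nQ.
  apply: contrapT => /not_orP[/contrapT Qf /contrapT Qg]; apply: nQ.
  by have [[[_ QD _] _] _] := Qpr x; exact: QD.
- move=> r f If; apply: (power_idealS Iid _ If) => x nQ Qf; apply: nQ.
  by have [[[_ _ QM] _] _] := Qpr x; exact: QM.
- move=> I1; apply: nI1; apply: (power_idealS Iid _ I1) => x _ /=.
  by have [[_]] := Qpr x.
- move=> f g Ifg; apply: Ipr; apply: (power_idealS Iid _ Ifg) => x [nQf nQg] Qfg.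
  by have [_ /(_ _ _ Qfg)[]] := Qpr x.
Qed.

Lemma limit_prime_idem Q I S : (forall x, is_prime_ideal (Q x)) ->
  limit_prime Q I (idem S) = I S.
Proof.
move=> Qpr; rewrite /limit_prime /=; congr (I _); apply/seteqP; split=> x /=.
  move=> nQ; apply: contrapT => nS; apply: nQ; rewrite idemF//.
  by have [[[]]] := Qpr x.
by move=> Sx; rewrite idemT//; have [[]] := Qpr x.
Qed.

Lemma trace_limit_prime Q I : (forall x, is_prime_ideal (Q x)) ->
  trace (limit_prime Q I) = I.
Proof.
by move=> Qpr; apply/funext => S; rewrite -[RHS](limit_prime_idem I S Qpr).
Qed.

(** The last two hypotheses make [limit_prime Q] and the trace inverse to each
other between [F] and the spectrum; [Q] is the family of zero ideals for minimal
primes and of maximal ideals for maximal ones. *)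
Lemma card_eq_Spec_power Q (F : set (set (prod_ring A))) :
  (forall x, is_prime_ideal (Q x)) ->
  F `<=` Spec (prod_ring A) ->
  (forall q, F q -> q = limit_prime Q (trace q)) ->
  (forall I, is_prime_ideal I -> F (limit_prime Q I)) ->
  F #= Spec (power_ring X).
Proof.
move=> Qpr FSpec FE FI.
suff <- : trace @` F = Spec (power_ring X).
  rewrite card_eq_sym; apply: inj_card_eq => q r /set_mem Fq /set_mem Fr e.
  by rewrite (FE _ Fq) (FE _ Fr) e.
apply/seteqP; split=> [_ [q /FSpec qpr <-]|I Ipr]; first exact: trace_prime.
by exists (limit_prime Q I); [exact: FI|exact: trace_limit_prime].
Qed.

(** Every prime contains the limit prime of its trace, since an element is a
multiple of the idempotent of its support.  That the zero ideal of [A x] is prime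
says that [A x] is an integral domain. *)
Lemma card_Min_prod_ring :
  (forall x, is_prime_ideal [set (0 : A x)]) ->
  Min (prod_ring A) #= Spec (power_ring X).
Proof.
move=> domA; pose Z x := [set (0 : A x)].
have sub q : is_prime_ideal q -> limit_prime Z (trace q) `<=` q.
  move=> [[[_ _ qM] _] _] f qf.
  by rewrite (@idem_supportE f [set x | f x <> 0])//; exact: qM.
apply: (@card_eq_Spec_power Z) => //.
- by move=> q [].
- move=> q [qpr qmin]; apply/esym/qmin; last exact: sub.
  by apply: limit_primeP => //; exact: trace_prime.
- move=> I Ipr; split=> [|q qpr qI]; first exact: limit_primeP.
  apply/seteqP; split=> //; suff <- : trace q = I by exact: sub.
  apply: power_prime_sub_eq => //; first exact: trace_prime.
  by move=> S /qI; rewrite limit_prime_idem.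
Qed.

(** Every prime is contained in the limit prime of its trace, since the idempotent
of the set where an element is invertible is a multiple of that element. *)
Lemma card_Max_prod_ring :
  (forall x, is_local_ring (A x)) ->
  Max (prod_ring A) #= Spec (power_ring X).
Proof.
move=> locA.
have [M Mmax] : exists M : forall x, set (A x), forall x, is_maximal_ideal (M x).
  suff /all_tag[M MP] : forall x, {N : set (A x) | is_maximal_ideal N} by exists M.
  by move=> x; apply: cid; have [N []] := locA x; exists N.
have Mpr x := maximal_is_prime (Mmax x).
have sub q : is_prime_ideal q -> q `<=` limit_prime M (trace q).
  move=> [[[_ _ qM] _] _] f qf.
  have /all_tag[g gP] x : {b | ~ M x (f x) -> b * f x = 1}.
    apply: cid; have [?|] := pselect (M x (f x)); first by exists 0.
    by move=> /(local_invertible (locA x) (Mmax x))[b bP]; exists b.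
  set S := [set x | ~ M x (f x)].
  rewrite /limit_prime /trace /= -/S.
  suff -> : idem S = (idem S * g) * f by exact: qM.
  apply: prod_ringP => x; rewrite !prod_ringM.
  have [Sx|nSx] := pselect (S x); first by rewrite idemT// mul1r gP.
  by rewrite idemF// !mul0r.
apply: (@card_eq_Spec_power M) => //.
- by move=> q /maximal_is_prime.
- move=> q qmax; have qpr := maximal_is_prime qmax.
  have [_ qM] := qmax; apply/esym/qM; last exact: sub.
  by have [] := limit_primeP Mpr (trace_prime qpr).
- move=> I Ipr; have [Lpr _] := limit_primeP Mpr Ipr; split=> // J Jpr LJ.
  have [K Kmax JK] := exists_maximal_ideal Jpr.
  have Kpr := maximal_is_prime Kmax.
  apply/seteqP; split=> //; suff -> : I = trace K.
    by apply: subset_trans JK _; exact: sub.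
  apply: power_prime_sub_eq => //; first exact: trace_prime.
  by move=> S IS; apply/JK/LJ; rewrite limit_prime_idem.
Qed.

End ProdRing.

Theorem corollary5p9 (X : Type) (D : X -> idomainType) (L : X -> comPzRingType) :
  infinite_set [set: X] ->
  (forall x : X, is_local_ring (L x)) ->
  [/\ Min (prod_ring (fun x => D x)) #= Max (prod_ring L),
      Max (prod_ring L) #= Spec (power_ring X) &
      Spec (power_ring X) #= [set: set (set X)]].
Proof.
move=> Xinf Lloc; have MaxE := card_Max_prod_ring Lloc.
split=> //; last exact: card_Spec_power_ring.
rewrite (card_eqr MaxE); apply: card_Min_prod_ring => x; split.
  split; last by apply/eqP; exact: oner_neq0.
  by split=> [//|_ _ -> ->|r _ ->] /=; rewrite ?addr0 ?mulr0.
move=> a b /eqP; rewrite mulf_eq0 => /orP[] /eqP; by [left|right].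
Qed.
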